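(* Let $(X,\odot,{}^*,1)$ be a (left-)quantum-MV algebra. Then $X$ is an MV algebra if and only if, for all $x,y\in X$, $x\le_m y$ implies $x\le_m^M y$.
   Context: An involutive left-m-BE algebra is an algebra $(X,\odot,{}^*,1)$ of type $(2,1,0)$ such that, with $0:=1^*$, for all $x,y,z\in X$: $1\odot x=x=x\odot 1$; $x\odot y=y\odot x$; $x\odot(y\odot z)=(x\odot y)\odot z$; $x\odot 0=0$; $x\odot x^*=0$; $x^{**}=x$. In it put $x\wedge_m^M y:=(x^*\odot y)^*\odot y$, $x\vee_m^M y:=(x^*\wedge_m^M y^* )^*$, $x\le_m^M y$ iff $x=x\wedge_m^M y$, and $x\le_m y$ iff $x\odot y^*=0$. A (left-)quantum-MV algebra is an involutive left-m-BE algebra satisfying $x\odot((x^*\vee_m^M y)\vee_m^M(z\vee_m^M x^* ))=(x\odot y)\vee_m^M(x\odot z)$ for all $x,y,z\in X$. A (left-)MV algebra is an involutive left-m-BE algebra satisfying $(x^*\odot y)^*\odot y=(y^*\odot x)^*\odot x$ for all $x,y\in X$. *)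

(* Defs.v *)
From mathcomp Require Import ssreflect ssrfun.

Set Implicit Arguments.
Unset Strict Implicit.
Unset Printing Implicit Defensive.

Declare Scope mBE_scope.
Delimit Scope mBE_scope with mBE.

Record algebra := Algebra {
  carrier :> Type;
  mul : carrier -> carrier -> carrier;
  star : carrier -> carrier;
  one : carrier
}.

Arguments one {a}.
Bind Scope mBE_scope with carrier.

Notation "x ⊙ y" := (mul x y) (at level 40, left associativity) : mBE_scope.
Notation "x ^*" := (star x) : mBE_scope.
Notation "1" := one : mBE_scope.

Local Open Scope mBE_scope.

Definition zero {X : algebra} : X := 1^*.
Notation "0" := zero : mBE_scope.

Definition meetM {X : algebra} (x y : X) : X := (x^* ⊙ y)^* ⊙ y.
Notation "x ∧M y" := (meetM x y) (at level 50, left associativity) : mBE_scope.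

Definition joinM {X : algebra} (x y : X) : X := (x^* ∧M y^*)^*.
Notation "x ∨M y" := (joinM x y) (at level 50, left associativity) : mBE_scope.

Definition leM {X : algebra} (x y : X) : Prop := x = x ∧M y.
Notation "x ≤M y" := (leM x y) (at level 70, no associativity) : mBE_scope.

Definition lem {X : algebra} (x y : X) : Prop := x ⊙ y^* = 0.
Notation "x ≤m y" := (lem x y) (at level 70, no associativity) : mBE_scope.

Record involutive_mBE (X : algebra) : Prop := InvolutiveMBE {
  mBE_mul1x : left_id 1 (@mul X);
  mBE_mulx1 : right_id 1 (@mul X);
  mBE_mulC : commutative (@mul X);
  mBE_mulA : associative (@mul X);
  mBE_mulx0 : right_zero 0 (@mul X);
  mBE_mulxN : right_inverse 0 (@star X) (@mul X);
  mBE_starK : involutive (@star X)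
}.

Record quantum_MV (X : algebra) : Prop := QuantumMV {
  qMV_mBE : involutive_mBE X;
  qMV_axiom : forall x y z : X,
    x ⊙ ((x^* ∨M y) ∨M (z ∨M x^*)) = (x ⊙ y) ∨M (x ⊙ z)
}.

Record MV (X : algebra) : Prop := MValg {
  MV_mBE : involutive_mBE X;
  MV_axiom : forall x y : X, (x^* ⊙ y)^* ⊙ y = (y^* ⊙ x)^* ⊙ x
}.

(* Main.v *)
(** If [≤m] implies [≤M], then every [a ≤m b] has the form [a = c ⊙ b], so [⊙] is
    monotone for [≤m].  Then [x ∧M y] is the greatest [≤m]-lower bound of [x] and [y]:
    for a lower bound [z], [z ≤M y] writes [z] as [(z^* ⊙ y)^* ⊙ y], which is monotone
    in [z], so [z ≤m x] gives [z ≤m (x^* ⊙ y)^* ⊙ y = x ∧M y].  As [≤m] is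
    antisymmetric, [∧M] is commutative. *)

From mathcomp Require Import ssreflect ssrfun.
Require Import Defs.
Local Open Scope mBE_scope.

Lemma star0 (X : algebra) : involutive_mBE X -> (0 : X)^* = 1.
Proof. by move=> hX; rewrite /zero (mBE_starK hX). Qed.

(** The first factor of [y ∧M x] is [0^* = 1]. Note the order: [≤M] concerns [x ∧M y] instead. *)
Lemma meetM_lem (X : algebra) (hX : involutive_mBE X) (x y : X) :
  x ≤m y -> y ∧M x = x.
Proof.
by move=> xy; rewrite /meetM (mBE_mulC hX (y^*)) xy (star0 _ hX) (mBE_mul1x hX).
Qed.

Lemma lem_star (X : algebra) (hX : involutive_mBE X) (x y : X) :
  x ≤m y -> y^* ≤m x^*.
Proof. by rewrite /lem (mBE_starK hX) (mBE_mulC hX). Qed.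

Lemma meetM_lem_l (X : algebra) (hX : involutive_mBE X) (x y : X) :
  x ∧M y ≤m x.
Proof.
by rewrite /lem /meetM -(mBE_mulA hX) (mBE_mulC hX y) (mBE_mulC hX) (mBE_mulxN hX).
Qed.

Lemma meetM_lem_r (X : algebra) (hX : involutive_mBE X) (x y : X) :
  x ∧M y ≤m y.
Proof. by rewrite /lem /meetM -(mBE_mulA hX) (mBE_mulxN hX) (mBE_mulx0 hX). Qed.

(** Both elements equal [y ∧M x]: [x] by [x ≤m y], and [y] by [y ≤M x]. *)
Lemma lem_anti (X : algebra) (hX : involutive_mBE X)
    (hle : forall x y : X, x ≤m y -> x ≤M y) (x y : X) :
  x ≤m y -> y ≤m x -> x = y.
Proof. by move=> xy /hle yx; rewrite -(meetM_lem _ hX _ _ xy) -yx. Qed.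

Lemma lem_mul2r (X : algebra) (hX : involutive_mBE X)
    (hle : forall x y : X, x ≤m y -> x ≤M y) (z x y : X) :
  x ≤m y -> x ⊙ z ≤m y ⊙ z.
Proof.
move=> /hle xy.
by rewrite /lem xy /meetM -!(mBE_mulA hX) (mBE_mulA hX y) (mBE_mulxN hX) (mBE_mulx0 hX).
Qed.

Lemma lem_meetM (X : algebra) (hX : involutive_mBE X)
    (hle : forall x y : X, x ≤m y -> x ≤M y) (z x y : X) :
  z ≤m x -> z ≤m y -> z ≤m x ∧M y.
Proof.
move=> zx /hle zy; rewrite {1}/lem [z in z ⊙ _]zy.
(* The goal unfolds from [z ∧M y ≤m x ∧M y]; the two stars around [z] and [x] reverse the order
   twice. *)
apply: (lem_mul2r _ hX hle); apply: (lem_star _ hX).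
exact/(lem_mul2r _ hX hle)/(lem_star _ hX).
Qed.

Theorem theorem5p13 (X : algebra) (hX : quantum_MV X) :
  MV X <-> (forall x y : X, x ≤m y -> x ≤M y).
Proof.
have hB := qMV_mBE hX; split=> [hMV x y xy | hle].
  (* The MV axiom is commutativity of [∧M], so it swaps [y ∧M x = x]. *)
  by rewrite /leM -[LHS](meetM_lem _ hB _ _ xy) /meetM (MV_axiom hMV).
split=> // x y; rewrite -!/(meetM _ _).
by apply: (lem_anti _ hB hle); apply: (lem_meetM _ hB hle);
  [exact: meetM_lem_r | exact: meetM_lem_l | exact: meetM_lem_r | exact: meetM_lem_l].
Qed.
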